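(* Let $n\ge2$. For a word $w$ in the letters $\sigma_i^{\pm1},\tau_i^{\pm1},v_i$ ($1\le i\le n-1$), let $\exp^C(w)=\sum_{i=1}^{n-1}\exp_{\sigma_i}(w)$ and $\exp^S(w)=\sum_{i=1}^{n-1}\exp_{\tau_i}(w)$, where $\exp_{\sigma_i}(w)$ and $\exp_{\tau_i}(w)$ denote the total exponent sums of $\sigma_i$ and of $\tau_i$ in $w$. Then $\exp^C$ and $\exp^S$ are well-defined group homomorphisms $VSG_n\to\mathbb{Z}$.
   Context: For $n\ge 2$, $VSG_n$ is the group with generators $\sigma_1,\dots,\sigma_{n-1},\tau_1,\dots,\tau_{n-1},v_1,\dots,v_{n-1}$ and relations (for all admissible indices): $\sigma_i\sigma_j=\sigma_j\sigma_i$, $v_iv_j=v_jv_i$, $\tau_i\tau_j=\tau_j\tau_i$, $\sigma_i\tau_j=\tau_j\sigma_i$, $\sigma_iv_j=v_j\sigma_i$, $\tau_iv_j=v_j\tau_i$ whenever $|i-j|\ge 2$; $v_i^2=1$ and $\sigma_i\tau_i=\tau_i\sigma_i$ for $1\le i\le n-1$; and for $1\le i\le n-2$: $\sigma_i\sigma_{i+1}\sigma_i=\sigma_{i+1}\sigma_i\sigma_{i+1}$, $v_iv_{i+1}v_i=v_{i+1}v_iv_{i+1}$, $\sigma_i\sigma_{i+1}\tau_i=\tau_{i+1}\sigma_i\sigma_{i+1}$, $\sigma_{i+1}\sigma_i\tau_{i+1}=\tau_i\sigma_{i+1}\sigma_i$, $v_i\sigma_{i+1}v_i=v_{i+1}\sigma_iv_{i+1}$,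 $v_i\tau_{i+1}v_i=v_{i+1}\tau_iv_{i+1}$. *)

(* Defs.v *)
From HB Require Import structures.
From mathcomp Require Import all_boot all_order all_algebra.
From mathcomp Require Import boolp.

Set Implicit Arguments.
Unset Strict Implicit.
Unset Printing Implicit Defensive.

Local Open Scope quotient_scope.
Local Open Scope ring_scope.

(* Words over T and its formal inverses: (t, false) stands for t, and         *)
(* (t, true) for the inverse of t. *)
Definition gword (T : Type) : Type := seq (T * bool).

Definition ginv_word (T : Type) (w : gword T) : gword T :=
  rev [seq (x.1, ~~ x.2) | x <- w].

Inductive pres_eq (T : Type) (rel : gword T -> gword T -> Prop) :
    gword T -> gword T -> Prop :=
| pres_eq_rel u v : rel u v -> pres_eq rel u v
| pres_eq_cancel t b : pres_eq rel [:: (t, b); (t, ~~ b)] [::]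
| pres_eq_refl u : pres_eq rel u u
| pres_eq_sym u v : pres_eq rel u v -> pres_eq rel v u
| pres_eq_trans u v w : pres_eq rel u v -> pres_eq rel v w -> pres_eq rel u w
| pres_eq_cat u u' v v' :
    pres_eq rel u u' -> pres_eq rel v v' -> pres_eq rel (u ++ v) (u' ++ v').

Section PresentedGroup.
Variables (T : choiceType) (rel : gword T -> gword T -> Prop).

Definition pres_eqb (u v : seq (T * bool)) : bool := `[< pres_eq rel u v >].

Lemma pres_eqb_refl : reflexive pres_eqb.
Proof. by move=> u; apply/asboolP/pres_eq_refl. Qed.

Lemma pres_eqb_sym : symmetric pres_eqb.
Proof. by move=> u v; apply/asboolP/asboolP; apply: pres_eq_sym. Qed.

Lemma pres_eqb_trans : transitive pres_eqb.
Proof.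
by move=> v u w /asboolP uv /asboolP vw; apply/asboolP/(pres_eq_trans uv vw).
Qed.

Canonical pres_equiv :=
  EquivRel pres_eqb pres_eqb_refl pres_eqb_sym pres_eqb_trans.

(* The group with generating set T and defining relations u = v, rel u v. *)
Definition presented : Type := {eq_quot pres_equiv}.
HB.instance Definition _ := Choice.copy presented {eq_quot pres_equiv}.
HB.instance Definition _ :=
  EqQuotient.copy presented {eq_quot pres_equiv}.

Lemma pi_presentedP (u v : seq (T * bool)) :
  reflect (\pi_presented u = \pi_presented v) `[< pres_eq rel u v >].
Proof. exact: eqmodP. Qed.

Lemma repr_presented (u : seq (T * bool)) :
  pres_eq rel (repr (\pi_presented u)) u.
Proof. by apply/asboolP/pi_presentedP; rewrite reprK. Qed.

Definition presented_one : presented := \pi_presented [::].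
Definition presented_mul (x y : presented) : presented :=
  \pi_presented (repr x ++ repr y).
Definition presented_inv (x : presented) : presented :=
  \pi_presented (ginv_word (repr x)).

Lemma pi_presentedM (u v : seq (T * bool)) :
  presented_mul (\pi_presented u) (\pi_presented v) = \pi_presented (u ++ v).
Proof. by apply/pi_presentedP/asboolP/pres_eq_cat; apply: repr_presented. Qed.

Lemma ginv_wordK : involutive (@ginv_word T).
Proof.
move=> w; rewrite /ginv_word map_rev revK -map_comp map_id_in // => -[t b] _ /=.
by rewrite negbK.
Qed.

Lemma pres_eq_mulV (w : gword T) : pres_eq rel (w ++ ginv_word w) [::].
Proof.
elim: w => [|[t b] w IHw]; first exact: pres_eq_refl.
have -> : ((t, b) :: w) ++ ginv_word ((t, b) :: w) =
    [:: (t, b)] ++ ((w ++ ginv_word w) ++ [:: (t, ~~ b)]).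
  by rewrite /ginv_word /= rev_cons -cats1 catA.
apply: pres_eq_trans (pres_eq_cancel rel t b).
apply: (pres_eq_cat (pres_eq_refl rel [:: (t, b)])).
exact: (pres_eq_cat IHw (pres_eq_refl rel [:: (t, ~~ b)])).
Qed.

Lemma presented_mulA : associative presented_mul.
Proof.
elim/quotW=> u; elim/quotW=> v; elim/quotW=> w.
by rewrite (pi_presentedM v) (pi_presentedM u v) !pi_presentedM catA.
Qed.

Lemma presented_mul1 : left_id presented_one presented_mul.
Proof. by elim/quotW=> u; rewrite pi_presentedM. Qed.

Lemma presented_mulr1 : right_id presented_one presented_mul.
Proof. by elim/quotW=> u; rewrite pi_presentedM cats0. Qed.

Lemma presented_mulV :
  left_inverse presented_one presented_inv presented_mul.
Proof.
move=> x; rewrite -{2}[x]reprK pi_presentedM; apply/pi_presentedP/asboolP.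
by rewrite -{2}[repr x]ginv_wordK; apply: pres_eq_mulV.
Qed.

Lemma presented_mulrV :
  right_inverse presented_one presented_inv presented_mul.
Proof.
move=> x; rewrite -{1}[x]reprK pi_presentedM; apply/pi_presentedP/asboolP.
exact: pres_eq_mulV.
Qed.

HB.instance Definition _ := isGroup.Build presented presented_mulA
  presented_mul1 presented_mulr1 presented_mulV presented_mulrV.

Definition pres_gen (t : T) : presented := \pi_presented [:: (t, false)].

End PresentedGroup.

(* The indices 1, ..., n-1 are represented by 'I_n.-1 = {0, ..., n-2}. *)
Inductive VSG_gen (n : nat) : Type :=
| GSigma of 'I_n.-1
| GTau of 'I_n.-1
| GV of 'I_n.-1.

Section VSGGenChoice.
Variable n : nat.

Definition VSG_gen_code (g : VSG_gen n) : 'I_n.-1 + 'I_n.-1 + 'I_n.-1 :=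
  match g with
  | GSigma i => inl (inl i)
  | GTau i => inl (inr i)
  | GV i => inr i
  end.

Definition VSG_gen_decode (c : 'I_n.-1 + 'I_n.-1 + 'I_n.-1) : VSG_gen n :=
  match c with
  | inl (inl i) => GSigma i
  | inl (inr i) => GTau i
  | inr i => GV i
  end.

Lemma VSG_gen_codeK : cancel VSG_gen_code VSG_gen_decode.
Proof. by case. Qed.

HB.instance Definition _ := Choice.copy (VSG_gen n) (can_type VSG_gen_codeK).

End VSGGenChoice.

Definition far (n : nat) (i j : 'I_n.-1) : bool :=
  (i + 2 <= j)%N || (j + 2 <= i)%N.

Section VSGRelations.
Variable n : nat.
Local Notation s i := (@GSigma n i, false).
Local Notation t i := (@GTau n i, false).
Local Notation v i := (@GV n i, false).

(* In the relations with hypothesis [j = i.+1], j plays the role of i+1. *)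
Inductive VSG_rel : gword (VSG_gen n) -> gword (VSG_gen n) -> Prop :=
| far_ss i j : far i j -> VSG_rel [:: s i; s j] [:: s j; s i]
| far_vv i j : far i j -> VSG_rel [:: v i; v j] [:: v j; v i]
| far_tt i j : far i j -> VSG_rel [:: t i; t j] [:: t j; t i]
| far_st i j : far i j -> VSG_rel [:: s i; t j] [:: t j; s i]
| far_sv i j : far i j -> VSG_rel [:: s i; v j] [:: v j; s i]
| far_tv i j : far i j -> VSG_rel [:: t i; v j] [:: v j; t i]
| rel_vv i : VSG_rel [:: v i; v i] [::]
| rel_st i : VSG_rel [:: s i; t i] [:: t i; s i]
| rel_sss (i j : 'I_n.-1) : j = i.+1 :> nat ->
    VSG_rel [:: s i; s j; s i] [:: s j; s i; s j]
| rel_vvv (i j : 'I_n.-1) : j = i.+1 :> nat ->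
    VSG_rel [:: v i; v j; v i] [:: v j; v i; v j]
| rel_sst (i j : 'I_n.-1) : j = i.+1 :> nat ->
    VSG_rel [:: s i; s j; t i] [:: t j; s i; s j]
| rel_sst' (i j : 'I_n.-1) : j = i.+1 :> nat ->
    VSG_rel [:: s j; s i; t j] [:: t i; s j; s i]
| rel_vsv (i j : 'I_n.-1) : j = i.+1 :> nat ->
    VSG_rel [:: v i; s j; v i] [:: v j; s i; v j]
| rel_vtv (i j : 'I_n.-1) : j = i.+1 :> nat ->
    VSG_rel [:: v i; t j; v i] [:: v j; t i; v j].

End VSGRelations.

Definition VSG (n : nat) : groupType := presented (@VSG_rel n).

Definition sigma (n : nat) (i : 'I_n.-1) : VSG n := pres_gen _ (GSigma i).
Definition tau (n : nat) (i : 'I_n.-1) : VSG n := pres_gen _ (GTau i).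
Definition vgen (n : nat) (i : 'I_n.-1) : VSG n := pres_gen _ (GV i).

(* Only the letters sigma_i and tau_i come with an inverse letter. *)
Inductive letter (n : nat) : Type :=
| LSigma of 'I_n.-1
| LSigmaV of 'I_n.-1
| LTau of 'I_n.-1
| LTauV of 'I_n.-1
| LV of 'I_n.-1.

Definition letter_val (n : nat) (x : letter n) : VSG n :=
  match x with
  | LSigma i => sigma i
  | LSigmaV i => (sigma i)^-1%g
  | LTau i => tau i
  | LTauV i => (tau i)^-1%g
  | LV i => vgen i
  end.

Definition word_val (n : nat) (w : seq (letter n)) : VSG n :=
  (\big[*%g/1%g]_(x <- w) letter_val x).

Definition sigma_exponent (n : nat) (i : 'I_n.-1) (x : letter n) : int :=
  match x with
  | LSigma j => (i == j)%:Z
  | LSigmaV j => - (i == j)%:Z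
  | _ => 0
  end.

Definition tau_exponent (n : nat) (i : 'I_n.-1) (x : letter n) : int :=
  match x with
  | LTau j => (i == j)%:Z
  | LTauV j => - (i == j)%:Z
  | _ => 0
  end.

Definition exp_sigma (n : nat) (i : 'I_n.-1) (w : seq (letter n)) : int :=
  \sum_(x <- w) sigma_exponent i x.

Definition exp_tau (n : nat) (i : 'I_n.-1) (w : seq (letter n)) : int :=
  \sum_(x <- w) tau_exponent i x.

Definition expC (n : nat) (w : seq (letter n)) : int :=
  \sum_(i < n.-1) exp_sigma i w.

Definition expS (n : nat) (w : seq (letter n)) : int :=
  \sum_(i < n.-1) exp_tau i w.

(* The additive group of the integers, as a multiplicative groupType. *)
Definition int_group : groupType := Algebra.to_multiplicative int.

(* Main.v *)
(* Both sides of every defining relation contain the same number of sigmas    *)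
(* and the same number of taus, so sending every sigma_i to a, every tau_i to *)
(* b and every v_i to 0 extends to a homomorphism from VSG_n to the integers; *)
(* (a, b) = (1, 0) gives exp^C and (a, b) = (0, 1) gives exp^S. *)

Require Import Defs.
From HB Require Import structures.
From mathcomp Require Import all_boot all_order all_algebra.
From mathcomp Require Import boolp.

Set Implicit Arguments.
Unset Strict Implicit.
Unset Printing Implicit Defensive.

Import GRing.Theory.

(** A map from the generators to a group [G] that respects the defining relations extends to the
    presented group ([presented_lift]). For [VSG n] the target is the integers; as they are
    commutative, a relation only has to balance its total weight on both sides ([VSG_weight_rel]).
    By [exponent_hom] the extension sends the class of a word to [a * expC w + b * expS w], so these
    sums depend only on the group element, and [word_val_surj] ensures that every element is
    reached. *)

Section PresentedLift.
Variables (T : choiceType) (rel : gword T -> gword T -> Prop).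
Local Open Scope group_scope.
Local Open Scope quotient_scope.

Lemma presented_mulE (u v : seq (T * bool)) :
  (\pi_(presented rel) (u ++ v) : presented rel) =
  (\pi_(presented rel) u : presented rel) * (\pi_(presented rel) v).
Proof. by rewrite -pi_presentedM. Qed.

Lemma pi_letter (t : T) (b : bool) :
  (\pi_(presented rel) [:: (t, b)] : presented rel) =
  if b then (pres_gen rel t)^-1 else pres_gen rel t.
Proof.
case: b => //; apply/divg1_eq; rewrite invgK -presented_mulE.
exact/pi_presentedP/asboolP/(pres_eq_cancel rel t true).
Qed.

Variables (G : groupType) (f : T -> G).

Definition gword_val (w : gword T) : G :=
  \big[*%g/1]_(x <- w) (if x.2 then (f x.1)^-1 else f x.1).

Lemma gword_val_cat u v : gword_val (u ++ v) = gword_val u * gword_val v.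
Proof. exact: big_cat. Qed.

Hypothesis f_rel : forall u v, rel u v -> gword_val u = gword_val v.

(** Induction on the derivation: [f_rel] settles the defining relations, inverses in [G] settle
    cancellation, and multiplicativity settles concatenation. *)
Lemma gword_val_pres_eq u v : pres_eq rel u v -> gword_val u = gword_val v.
Proof.
elim=> {u v} [u v /f_rel //|t b|//|u v _ -> //|u v w _ -> _ -> //|].
  rewrite /gword_val !big_cons big_nil mulg1.
  by case: b; rewrite /= ?mulVg ?mulgV.
by move=> u u' v v' _ Hu _ Hv; rewrite !gword_val_cat Hu Hv.
Qed.

Lemma presented_lift :
  exists phi : UMagmaMorphism.type (presented rel) G,
    forall t, phi (pres_gen rel t) = f t.
Proof.
pose h (x : presented rel) : G := gword_val (repr x).
(* The choice of representative does not matter, since [gword_val] is constant on classes. *)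
have h_pi (u : seq (T * bool)) : h (\pi_(presented rel) u) = gword_val u.
  exact/gword_val_pres_eq/repr_presented.
have hM : {morph h : x y / x * y} by move=> x y; rewrite h_pi gword_val_cat.
have h1 : h 1 = 1 by rewrite [LHS]h_pi /gword_val big_nil.
pose hm := isUMagmaMorphism.Build _ _ h (h1, hM).
pose phi : UMagmaMorphism.type (presented rel) G := HB.pack h hm.
by exists phi => t; rewrite [LHS]h_pi /gword_val big_seq1.
Qed.

End PresentedLift.

Section ExponentSums.
Variable n : nat.
Local Open Scope ring_scope.

Lemma vgenV (i : 'I_n.-1) : ((vgen i)^-1 = vgen i)%g.
Proof.
apply/esym/divg1_eq; rewrite invgK -presented_mulE.
by apply/pi_presentedP/asboolP/pres_eq_rel/rel_vv.
Qed.

Lemma word_val_surj (x : VSG n) : exists w : seq (letter n), word_val w = x.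
Proof.
elim/quotW: x; elim=> [|[g b] u [w Hw]].
  by exists [::]; rewrite /word_val big_nil.
pose l := match g with
  | GSigma i => if b then LSigmaV i else LSigma i
  | GTau i => if b then LTauV i else LTau i
  | GV i => LV i
  end.
exists (l :: w); rewrite /word_val big_cons -/(word_val w) Hw.
rewrite -cat1s presented_mulE pi_letter; congr (_ * _)%g.
(* Words have no inverse letter for [vgen i], but [vgen i] is an involution, so [LV i] serves for
   both signs. *)
by rewrite /l; case: g {l} => i; case: b => //=; rewrite vgenV.
Qed.

Definition VSG_weight (a b : int) (g : VSG_gen n) : int_group :=
  match g with GSigma _ => a | GTau _ => b | GV _ => 1%g end.

Lemma VSG_weight_rel a b u v : VSG_rel u v ->
  gword_val (VSG_weight a b) u = gword_val (VSG_weight a b) v.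
Proof.
(* The product of [int_group] is addition of integers. *)
have mulC (x y : int_group) : (x * y = y * x)%g by exact: addrC.
case=> *; rewrite /gword_val !big_cons big_nil /= ?mulg1 ?mul1g ?mulgA //;
  by rewrite mulC mulgA.
Qed.

Lemma exponent_hom (a b : int) :
  exists phi : UMagmaMorphism.type (VSG n) int_group,
    forall w : seq (letter n), phi (word_val w) = a * expC w + b * expS w.
Proof.
have [phi phiE] := presented_lift (@VSG_weight_rel a b).
exists phi => w.
have sum_eq j : \sum_(i < n.-1) (i == j)%:Z = 1.
  by rewrite (bigD1 j) //= eqxx big1 ?addr0 // => i /negPf ->.
rewrite /expC /expS /exp_sigma /exp_tau.
(* With the sum over letters outermost, the identity can be checked one letter at a time; by
   [sum_eq] each letter counts for exactly one index. *)
rewrite [in X in a * X]exchange_big [in X in b * X]exchange_big /=.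
rewrite !mulr_sumr -big_split /word_val gmulf_prod.
apply: eq_bigr => -[] i _ /=; rewrite ?gmulfV [phi _]phiE /= ?sumrN ?sum_eq.
all: by rewrite ?big1_eq ?mulr0 ?mulrN ?mulr1 ?addr0 ?add0r.
Qed.

End ExponentSums.

Theorem proposition10 (n : nat) (hn : (2 <= n)%N) :
  [/\ forall x : VSG n, exists w : seq (letter n), word_val w = x,
      forall w1 w2 : seq (letter n), word_val w1 = word_val w2 ->
        expC w1 = expC w2 /\ expS w1 = expS w2
    & exists (phiC phiS : {multiplicative VSG n -> int_group}),
        forall w : seq (letter n),
          phiC (word_val w) = expC w /\ phiS (word_val w) = expS w].
Proof.
have [phiC phiCE] := exponent_hom n 1%R 0%R.
have [phiS phiSE] := exponent_hom n 0%R 1%R.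
have phiE w : phiC (word_val w) = expC w /\ phiS (word_val w) = expS w.
  by rewrite phiCE phiSE !mul0r !mul1r addr0 add0r.
split; [exact: word_val_surj | | by exists phiC, phiS].
(* Both sums are values of functions at [word_val w], hence well defined. *)
move=> w1 w2 eqw; have [<- <-] := phiE w1; have [<- <-] := phiE w2.
by rewrite eqw.
Qed.
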